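(* Let $r\ge 2$, let $h:\mathbb{R}^n\to\mathbb{R}$ be a $C^r$ function with relative degree $r$ with respect to $\dot x=f(x)+g(x)u$, and let $\mathcal{C}=\{x\in\mathbb{R}^n: h(x)\ge 0\}$. Let $\lambda_1,\dots,\lambda_r>0$ and define $s_0=h$ and $s_k=\left(\frac{d}{dt}+\lambda_k\right)s_{k-1}$ along the plant for $k\ge1$. Suppose that $s_k:\mathbb{R}^n\to\mathbb{R}$ is globally Lipschitz with Lipschitz constant $L_k>0$ for $k=0,1,\dots,r-1$. Let $x(t)$ and $\hat x(t)$ denote the state of the plant and of its estimation error quantified (EEQ) observer with error bound $M(t)$, so that $\hat x$ satisfies the reconstructed system $$\dot{\hat x}=f(\hat x)+g(\hat x)u+\sum_{i=1}^N\theta_i\varphi_i(t)+\epsilon_\Lambda(t)$$ with unknown constant parameters $\theta_i\in\mathbb{R}^n$. Suppose $\|\epsilon_\Lambda(t)\|\le E$ for a constant $E>0$, and $\|\theta_i\|\le\bar\theta_i$ for known constants $\bar\theta_i>0$, $i=1,\dots,N$. Let $\mu>0$ and $\epsilon>0$ be constants, and define $$s_k^M(\hat x,t)=s_k(\hat x)-L_kM(t)\quad(k=0,1,\dots,r-1),\qquad s_\epsilon(\hat x,t)=s_{r-1}^M(\hat x,t)-\epsilon .$$ Suppose the parameter estimates $\hat\theta_i(t)\in\mathbb{R}^n$, $i=1,\dots,N$, are governed by $$\dot{\hat\theta}_i=-\frac{\bar\theta_i^2}{2\epsilon}\,\frac{\partial s_\epsilon}{\partial\hat x}\,\varphi_i-\mu\hat\theta_i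 .$$ If $\epsilon$ satisfies $$0<\epsilon\le\frac{\min\{s_0^M(\hat x(0),0),\,s_1^M(\hat x(0),0),\dots,s_{r-1}^M(\hat x(0),0)\}}{N+\sum_{i=1}^N\left(\frac{2\|\hat\theta_i(0)\|}{\bar\theta_i}+\frac{\|\hat\theta_i(0)\|^2}{\bar\theta_i^2}\right)},$$ then any Lipschitz continuous controller $u$ (a function of $(\hat x,\hat\theta,t)$) with $u\in K_{BF}(\hat x,\hat\theta,t)$, where $$K_{BF}(\hat x,\hat\theta,t)=\left\{u\in\mathbb{R}^m:\ L_g s_\epsilon\,u+L_{\tilde f}s_\epsilon-\mu N\epsilon+\frac{\partial s_\epsilon}{\partial t}-\left\|\frac{\partial s_\epsilon}{\partial\hat x}\right\|E+\mu s_\epsilon\ge 0\right\},\qquad \tilde f=f(\hat x)+\sum_{i=1}^N\hat\theta_i\varphi_i(t),$$ guarantees the forward invariance of $\mathcal{C}$, i.e. along the closed-loop trajectory, $h(x(t))\ge 0$ for all $t\ge 0$.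
   Context: Plant: $\dot x=f(x)+g(x)u$, $y=l(x)$, with state $x\in\mathbb{R}^n$, input $u\in\mathbb{R}^m$, output $y\in\mathbb{R}^k$, where $f:\mathbb{R}^n\to\mathbb{R}^n$ and $g:\mathbb{R}^n\to\mathbb{R}^{n\times m}$ are locally Lipschitz (and smooth enough for the Lie derivatives below to exist and for $s_0,\dots,s_{r-1}$ to be continuously differentiable) and $l:\mathbb{R}^n\to\mathbb{R}^k$. $\|\cdot\|$ is the Euclidean norm. Relative degree and the functions $s_k$: $h$ has relative degree $r$ if $L_gL_f^{j}h\equiv 0$ for $0\le j\le r-2$ and $L_gL_f^{r-1}h\neq 0$, where $L_fh=\frac{\partial h}{\partial x}f$ and $L_gh=\frac{\partial h}{\partial x}g$. Consequently for $1\le k\le r-1$ the function $s_k=\left(\frac{d}{dt}+\lambda_k\right)s_{k-1}$ does not depend on $u$ and equals $s_k(x)=L_fs_{k-1}(x)+\lambda_ks_{k-1}(x)$. The numbers $-\lambda_1,\dots,-\lambda_r<0$ are the (negative real) roots of a chosen polynomial $\lambda^r+a_1\lambda^{r-1}+\dots+a_r$. Observer: $\dot{\hat x}=v(\hat x,y,u)$, with $\hat x\in\mathbb{R}^n$. It is an estimation error quantified (EEQ) observer if $\|\hat x(t)-x(t)\|\le M(t)$ for all $t\ge 0$, where $M(t)=M(t,x(0),\hat x(0))\ge 0$ is a known non-negative function of time ($M$ is differentiable in $t$, so that $\partial s_\epsilon/\partial t=-L_{r-1}\dot M(t)$ makes sense). Reconstructed system: with $e=\hat x-x$, one has identically $\dot{\hat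 x}=f(\hat x)+g(\hat x)u+\Lambda$, where $\Lambda=\dot e+(f(x)-f(\hat x))+(g(x)-g(\hat x))u\in\mathbb{R}^n$. Along the closed-loop trajectory $\Lambda$ is a function of time and is written $\Lambda=\sum_{i=1}^N\theta_i\varphi_i(t)+\epsilon_\Lambda(t)$, with $N$ a positive integer, $\theta_i\in\mathbb{R}^n$ unknown constant vectors, $\epsilon_\Lambda(t)\in\mathbb{R}^n$ the truncation error, and scalar trigonometric basis functions (for a frequency $\omega$) $\varphi_0(t)=1$, $\varphi_{2k-1}(t)=\cos k\omega t$, $\varphi_{2k}(t)=\sin k\omega t$ for $k\ge 1$. Conventions: the gradient $\partial s_\epsilon/\partial\hat x$ is viewed as a column vector; $L_g s_\epsilon=(\partial s_\epsilon/\partial\hat x)^\top g(\hat x)$ and $L_{\tilde f}s_\epsilon=(\partial s_\epsilon/\partial\hat x)^\top\tilde f$; $\hat\theta$ collects $\hat\theta_1,\dots,\hat\theta_N$. Closed-loop trajectories $(x(t),\hat x(t),\hat\theta(t))$ are understood to exist for all $t\ge0$. *)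

(* Defs.v *)
(* Vectors of R^n are the column vectors 'cV[R]_n. *)
From HB Require Import structures.
From mathcomp Require Import all_boot all_order all_algebra.
From mathcomp Require Import all_classical all_reals all_analysis.

Set Implicit Arguments.
Unset Strict Implicit.
Unset Printing Implicit Defensive.

Import Order.TTheory GRing.Theory Num.Theory.
Import numFieldNormedType.Exports.
Local Open Scope classical_set_scope.
Local Open Scope ring_scope.

(* The library norm `|v| on matrices is the maximum norm, whereas the Lipschitz
   constants and error bounds below are Euclidean. *)
Definition enorm (R : realType) (n : nat) (v : 'cV[R]_n) : R :=
  Num.sqrt (\sum_(i < n) v i 0 ^+ 2).

Definition gradient (R : realType) (n : nat) (h : 'cV[R]_n -> R)
    (x : 'cV[R]_n) : 'cV[R]_n :=
  \col_i 'D_(delta_mx i 0) h x.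

Fixpoint is_Ck (R : realType) (n k : nat) (h : 'cV[R]_n -> R) : Prop :=
  if k is k'.+1 then
    (forall x, differentiable h x) /\
    (forall i, is_Ck k' (fun x => gradient h x i 0))
  else continuous h.

(* Insensitive to the choice of the norms, which are equivalent in finite
   dimension. *)
Definition locally_lipschitz_on (R : realType) (V W : normedModType R)
    (A : set V) (F : V -> W) : Prop :=
  forall x, A x -> exists2 U, nbhs x U & [lipschitz F y | y in U `&` A].

(* L_f h for a vector field f, and the row vector L_g h for a matrix-valued g *)
Definition lie (R : realType) (n : nat) (f : 'cV[R]_n -> 'cV[R]_n)
    (h : 'cV[R]_n -> R) (x : 'cV[R]_n) : R :=
  ((gradient h x)^T *m f x) 0 0.

Definition lie_input (R : realType) (n m : nat) (g : 'cV[R]_n -> 'M[R]_(n, m))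
    (h : 'cV[R]_n -> R) (x : 'cV[R]_n) : 'rV[R]_m :=
  (gradient h x)^T *m g x.

(* The first clause makes the (total) Lie derivatives of the other two
   meaningful. The last one says that the function L_g L_f^(r-1) h is not the
   zero function; it is implied by the variant that asks for a nonzero value at
   every point. *)
Definition has_relative_degree (R : realType) (n m : nat)
    (f : 'cV[R]_n -> 'cV[R]_n) (g : 'cV[R]_n -> 'M[R]_(n, m))
    (h : 'cV[R]_n -> R) (r : nat) : Prop :=
  [/\ forall j, (j < r)%N -> forall x, differentiable (iter j (lie f) h) x,
      forall j, (j.+2 <= r)%N -> forall x, lie_input g (iter j (lie f) h) x = 0
    & exists x, lie_input g (iter r.-1 (lie f) h) x != 0].

(* (d/dt + lambda_k) s_(k-1) along x' = f(x) + g(x) u is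
   L_f s_(k-1) + (L_g s_(k-1)) u + lambda_k s_(k-1); for k smaller than the
   relative degree of h the term in u is zero, and only those k are used. *)
Fixpoint cbf_chain (R : realType) (n : nat) (f : 'cV[R]_n -> 'cV[R]_n)
    (h : 'cV[R]_n -> R) (lambda : nat -> R) (k : nat) : 'cV[R]_n -> R :=
  if k is k'.+1 then
    fun x => lie f (cbf_chain f h lambda k') x
             + lambda k * cbf_chain f h lambda k' x
  else h.

(* Trajectories live on t >= 0. They are represented by total functions on R
   whose values at negative times are unconstrained, so that the derivative at
   t = 0 only expresses the one-sided one (a function on [0, +oo[ with a right
   derivative at 0 can be continued to the left differentiably). *)
Definition solves (R : realType) (V : normedModType R) (z F : R -> V) : Prop :=
  forall t : R, 0 <= t -> is_derive t (1 : R) z (F t).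

Definition plant_trajectory (R : realType) (n m : nat)
    (f : 'cV[R]_n -> 'cV[R]_n) (g : 'cV[R]_n -> 'M[R]_(n, m))
    (u : R -> 'cV[R]_m) (x : R -> 'cV[R]_n) : Prop :=
  solves x (fun t => f (x t) + g (x t) *m u t).

(* M t x0 xhat0 is the error bound at time t from the initial states x0 of the
   plant and xhat0 of the observer; see solves about t = 0. *)
Definition error_bound (R : realType) (n : nat)
    (M : R -> 'cV[R]_n -> 'cV[R]_n -> R) : Prop :=
  forall (x0 xhat0 : 'cV[R]_n) (t : R), 0 <= t ->
    0 <= M t x0 xhat0 /\ derivable (fun tau : R => M tau x0 xhat0) t 1.

Definition eeq_observer_trajectory (R : realType) (n m p : nat)
    (l : 'cV[R]_n -> 'cV[R]_p)
    (v : 'cV[R]_n -> 'cV[R]_p -> 'cV[R]_m -> 'cV[R]_n)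
    (M : R -> 'cV[R]_n -> 'cV[R]_n -> R)
    (u : R -> 'cV[R]_m) (x xhat : R -> 'cV[R]_n) : Prop :=
  solves xhat (fun t => v (xhat t) (l (x t)) (u t)) /\
  (forall t : R, 0 <= t -> enorm (xhat t - x t) <= M t (x 0) (xhat 0)).

Definition trig_basis (R : realType) (omega : R) (i : nat) (t : R) : R :=
  if i == 0%N then 1
  else if odd i then cos ((i.+1./2)%:R * omega * t)
  else sin ((i./2)%:R * omega * t).

(* In the sums over i = 1, ..., N, the index i is represented by i - 1 : 'I_N,
   hence the function trig_basis omega i.+1; phi_0 does not occur. *)
Definition reconstructed_trajectory (R : realType) (n m N : nat)
    (f : 'cV[R]_n -> 'cV[R]_n) (g : 'cV[R]_n -> 'M[R]_(n, m))
    (omega : R) (theta : 'I_N -> 'cV[R]_n) (epsLambda : R -> 'cV[R]_n)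
    (u : R -> 'cV[R]_m) (xhat : R -> 'cV[R]_n) : Prop :=
  solves xhat (fun t => f (xhat t) + g (xhat t) *m u t
    + \sum_(i < N) trig_basis omega i.+1 t *: theta i + epsLambda t).

(* Here and below M is the error bound as a function of time only. *)
Definition sM (R : realType) (n : nat) (s : nat -> 'cV[R]_n -> R)
    (L : nat -> R) (M : R -> R) (k : nat) (z : 'cV[R]_n) (t : R) : R :=
  s k z - L k * M t.

Definition s_eps (R : realType) (n : nat) (s : nat -> 'cV[R]_n -> R)
    (L : nat -> R) (M : R -> R) (r : nat) (eps : R)
    (z : 'cV[R]_n) (t : R) : R :=
  sM s L M r.-1 z t - eps.

(* The estimates thetahat_1, ..., thetahat_N are the columns of a matrix. *)
Definition f_tilde (R : realType) (n N : nat) (f : 'cV[R]_n -> 'cV[R]_n)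
    (omega : R) (thetahat : 'M[R]_(n, N)) (t : R) (z : 'cV[R]_n) : 'cV[R]_n :=
  f z + \sum_(i < N) trig_basis omega i.+1 t *: col i thetahat.

Definition adaptation_law (R : realType) (n N : nat)
    (se : 'cV[R]_n -> R -> R) (omega mu eps : R) (thetabar : 'I_N -> R)
    (xhat : R -> 'cV[R]_n) (thetahat : R -> 'M[R]_(n, N)) : Prop :=
  forall i : 'I_N, solves (fun t => col i (thetahat t)) (fun t =>
    - ((thetabar i ^+ 2 / (2 * eps) * trig_basis omega i.+1 t)
         *: gradient (se^~ t) (xhat t))
    - mu *: col i (thetahat t)).

Definition K_BF (R : realType) (n m N : nat)
    (f : 'cV[R]_n -> 'cV[R]_n) (g : 'cV[R]_n -> 'M[R]_(n, m))
    (se : 'cV[R]_n -> R -> R) (omega mu eps E : R)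
    (z : 'cV[R]_n) (thetahat : 'M[R]_(n, N)) (t : R) : set 'cV[R]_m :=
  [set u | 0 <= (lie_input g (se^~ t) z *m u) 0 0
                + lie (f_tilde f omega thetahat t) (se^~ t) z
                - mu * N%:R * eps
                + derive1 (se z) t
                - enorm (gradient (se^~ t) z) * E
                + mu * se z t].

Definition eps_bound (R : realType) (n N r : nat)
    (s : nat -> 'cV[R]_n -> R) (L : nat -> R) (M : R -> R)
    (thetabar : 'I_N -> R) (xhat0 : 'cV[R]_n) (thetahat0 : 'M[R]_(n, N)) : R :=
  (\big[Num.min/sM s L M 0 xhat0 0]_(1 <= k < r) sM s L M k xhat0 0)
  / (N%:R + \sum_(i < N) (2 * enorm (col i thetahat0) / thetabar i
                          + enorm (col i thetahat0) ^+ 2 / thetabar i ^+ 2)).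

Definition safe_set (R : realType) (n : nat) (h : 'cV[R]_n -> R)
    : set 'cV[R]_n := [set x | 0 <= h x].

(* Main.v *)
Require Import Defs.
From HB Require Import structures.
From mathcomp Require Import all_boot all_order all_algebra.
From mathcomp Require Import all_classical all_reals all_analysis.
From mathcomp Require Import ring lra zify.

Import Order.TTheory GRing.Theory Num.Theory.
Import numFieldNormedType.Exports.
Local Open Scope classical_set_scope.
Local Open Scope ring_scope.

(** Write G for the gradient of s_(r-1) at xhat(t). The proof has an adaptive
    part, about the observer, and a cascade part, about the plant.

    Adaptive part. Let the energy be
      W = s_eps - sum_i (eps / thetabar_i^2) |theta_i - thetahat_i|^2.
    Along the trajectory the unknown theta_i enters s_eps' through the term
    phi_i G . theta_i. The gain thetabar_i^2 / (2 eps) of the adaptation law is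
    chosen so that the derivative of the quadratic term replaces theta_i there by
    its estimate, up to a leakage error of at most mu eps per coefficient
    ([adaptation_dissipation]); the truncation error costs at most |G| E, by
    Cauchy-Schwarz. Membership of u in K_BF pays for exactly these quantities,
    so W' + mu W >= 0. The bound on eps says that s_(r-1)^M(xhat(0), 0) is at
    least eps (N + sum_i (...)), and this dominates the quadratic term at time 0;
    hence W(0) >= -eps, and so W >= -eps for all times because mu >= 0
    ([exp_lower_bound], [barrier_energy_ge]). As the quadratic term is
    nonnegative, s_eps >= -eps, that is s_(r-1)^M(xhat(t), t) >= 0.

    Cascade part. The Lipschitz bound and |xhat - x| <= M give
    s_k^M(xhat(t), t) <= s_k(x(t)), so s_(r-1)(x(t)) >= 0 for all t, and the bound
    on eps gives s_k(x(0)) >= 0 for every k. Below the relative degree the input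
    does not appear in the derivative of s_k ([lie_input_iter_chain]), so along the
    plant s_k' + lambda_(k+1) s_k = s_(k+1). By descending induction on k every s_k
    stays nonnegative, down to s_0 = h ([chain_nonneg]). *)

(** * Euclidean inner product and norm *)

Section Euclidean.
Context {R : realType} {n : nat}.
Implicit Types v w : 'cV[R]_n.

Lemma dotE v w : (v^T *m w) 0 0 = \sum_(i < n) v i 0 * w i 0.
Proof. by rewrite mxE; apply: eq_bigr => i _; rewrite mxE. Qed.

Lemma enorm_ge0 v : 0 <= enorm v.
Proof. exact: sqrtr_ge0. Qed.

Lemma sqr_enorm v : enorm v ^+ 2 = \sum_(i < n) v i 0 ^+ 2.
Proof. by rewrite sqr_sqrtr// sumr_ge0// => i _; rewrite sqr_ge0. Qed.

Lemma sqr_enorm_comb (a b : R) v w :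
  enorm (a *: v + b *: w) ^+ 2 =
  a ^+ 2 * enorm v ^+ 2 + 2 * a * b * (v^T *m w) 0 0 + b ^+ 2 * enorm w ^+ 2.
Proof.
rewrite !sqr_enorm dotE !mulr_sumr -!big_split/=; apply: eq_bigr => i _.
by rewrite !mxE; ring.
Qed.

Lemma cauchy_schwarz v w : `|(v^T *m w) 0 0| <= enorm v * enorm w.
Proof.
rewrite -(@ler_pXn2r _ 2)// ?nnegrE ?mulr_ge0 ?enorm_ge0// real_normK ?num_real//.
set d := (_ *m _) 0 0; rewrite exprMn.
have [w0|w_neq0] := eqVneq (enorm w ^+ 2) 0.
  have /allP w_eq0 : all (fun i => w i 0 ^+ 2 == 0) (index_enum 'I_n).
    move/eqP: w0; rewrite sqr_enorm psumr_eq0// => i _.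
    exact: sqr_ge0.
  rewrite w0 mulr0 /d dotE big1 ?expr0n// => i _.
  have := w_eq0 i (mem_index_enum i).
  by rewrite sqrf_eq0 => /eqP ->; rewrite mulr0.
have w_gt0 : 0 < enorm w ^+ 2 by rewrite lt_neqAle eq_sym w_neq0 sqr_ge0.
(* This vector is |w|^2 times the component of v orthogonal to w. *)
have := sqr_ge0 (enorm (enorm w ^+ 2 *: v + - d *: w)).
rewrite sqr_enorm_comb -/d.
have -> : (enorm w ^+ 2) ^+ 2 * enorm v ^+ 2 + 2 * enorm w ^+ 2 * - d * d
    + (- d) ^+ 2 * enorm w ^+ 2
  = enorm w ^+ 2 * (enorm v ^+ 2 * enorm w ^+ 2 - d ^+ 2) by ring.
by rewrite pmulr_rge0// subr_ge0.
Qed.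

Lemma sqr_enormB v w :
  enorm (v - w) ^+ 2 = enorm v ^+ 2 - 2 * (v^T *m w) 0 0 + enorm w ^+ 2.
Proof.
have := sqr_enorm_comb 1 (- 1) v w; rewrite scale1r scaleN1r => ->.
by ring.
Qed.

Lemma sqr_enormB_le v w : enorm (v - w) ^+ 2 <= (enorm v + enorm w) ^+ 2.
Proof.
rewrite sqr_enormB.
by have := cauchy_schwarz v w; rewrite ler_norml => /andP[+ _]; nra.
Qed.

End Euclidean.

(** * Derivatives along trajectories and a comparison principle *)

Section Calculus.
Context {R : realType} {n : nat}.

Lemma diff_gradient (s : 'cV[R]_n -> R) z w :
  differentiable s z -> 'd s z w = ((gradient s z)^T *m w) 0 0.
Proof.
move=> ds; rewrite dotE {1}[w]matrix_sum_delta linear_sum.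
apply: eq_bigr => i _; rewrite big_ord1 linearZZ mxE deriveE//.
exact: mulrC.
Qed.

Lemma is_derive_along (s : 'cV[R]_n -> R) (z : R -> 'cV[R]_n) (t : R) dz :
  differentiable s (z t) -> is_derive t 1 z dz ->
  is_derive t 1 (fun tau => s (z tau)) (((gradient s (z t))^T *m dz) 0 0).
Proof.
move=> ds [/derivable1_diffP difz <-].
have difsz : differentiable (s \o z) t by exact: differentiable_comp.
apply: DeriveDef; first exact/derivable1_diffP.
by rewrite deriveE// diff_comp//= diff_gradient// deriveE.
Qed.

Lemma is_derive_sqr_enorm (z : R -> 'cV[R]_n) (t : R) dz :
  is_derive t 1 z dz ->
  is_derive t 1 (fun tau => enorm (z tau) ^+ 2) (2 * ((z t)^T *m dz) 0 0).
Proof.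
move=> [dz1 dz2].
have dzi i : is_derive t 1 (fun tau => z tau i 0) (dz i 0).
  by apply: DeriveDef; [exact: (derivable_mxP _ _ _).1 | rewrite -dz2 derive_mx// mxE].
rewrite (_ : (fun _ => _) = \sum_(i < n) (fun tau => z tau i 0) ^+ 2); last first.
  by apply/funext => tau; rewrite sqr_enorm fct_sumE.
apply: is_derive_eq; rewrite dotE mulr_sumr; apply: eq_bigr => i _.
by rewrite expr1 -[_ *: _]/(_ * _); ring.
Qed.

(** The function exp (mu t) W t is nondecreasing, so W t >= exp (- mu t) W 0; when
    c is not positive, shrinking c by the factor exp (- mu t) only raises it. *)
Lemma exp_lower_bound (W dW : R -> R) (mu c : R) :
  0 <= mu -> c <= 0 -> c <= W 0 ->
  (forall t : R, 0 <= t -> is_derive t 1 W (dW t)) ->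
  (forall t : R, 0 <= t -> 0 <= dW t + mu * W t) ->
  forall t : R, 0 <= t -> c <= W t.
Proof.
move=> mu0 c0 cW dWP W0 t t0.
pose G := (fun tau : R => expR (mu * tau)) * W.
have dG (tau : R) : 0 <= tau ->
    is_derive tau 1 G (expR (mu * tau) * (dW tau + mu * W tau)).
  move=> tau0; have ? := dWP _ tau0.
  have ? : is_derive tau 1 (fun tau : R => mu * tau) mu.
    by apply: is_derive_eq; rewrite -[_ *: _]/(_ * _) mulr1.
  have ? := is_derive1_comp (f := expR) (is_derive_expR (mu * tau)) _.
  by apply: is_derive_eq; rewrite -![_ *: _]/(_ * _); ring.
have Gt : W 0 <= expR (mu * t) * W t.
  have -> : W 0 = G 0 by rewrite /G fctE mulr0 expR0 mul1r.
  apply: (@ger0_derive1_ndecr _ G 0 t) => //.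
  - by move=> y; rewrite in_itv/= => /andP[/ltW/dG[]].
  - move=> y; rewrite in_itv/= => /andP[/ltW y0 _].
    by rewrite derive1E; have [_ ->] := dG _ y0; rewrite mulr_ge0 ?expR_ge0 ?W0.
  - apply: derivable_within_continuous => y.
    by rewrite in_itv/= => /andP[/dG[]].
have e1 : 1 <= expR (mu * t) by rewrite -expR0 ler_expR mulr_ge0.
by case: (leP c (W t)) => // Wt; exfalso; nra.
Qed.

End Calculus.

(** * The cascade of functions s_k below the relative degree *)

Section Chain.
Context {R : realType} {n m : nat}.
Variables (f : 'cV[R]_n -> 'cV[R]_n) (g : 'cV[R]_n -> 'M[R]_(n, m)).

Lemma gradient_comb (p q : 'cV[R]_n -> R) (a : R) z :
  differentiable p z -> differentiable q z ->
  gradient (fun y => p y + a * q y) z = gradient p z + a *: gradient q z.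
Proof.
move=> dp dq; apply/colP => i; rewrite !mxE.
have -> : (fun y => p y + a * q y) = p + a \*: q by apply/funext.
by rewrite deriveD ?deriveZ//; [exact: diff_derivable..|];
  apply/derivableZ/diff_derivable.
Qed.

Lemma lie_comb (p q : 'cV[R]_n -> R) (a : R) z :
  differentiable p z -> differentiable q z ->
  lie f (fun y => p y + a * q y) z = lie f p z + a * lie f q z.
Proof.
move=> dp dq; rewrite /lie gradient_comb//.
by rewrite linearD linearZ mulmxDl -scalemxAl !mxE.
Qed.

Lemma lie_input_comb (p q : 'cV[R]_n -> R) (a : R) z :
  differentiable p z -> differentiable q z ->
  lie_input g (fun y => p y + a * q y) z =
  lie_input g p z + a *: lie_input g q z.
Proof.
move=> dp dq; rewrite /lie_input gradient_comb//.
by rewrite linearD linearZ mulmxDl -scalemxAl.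
Qed.

Variables (h : 'cV[R]_n -> R) (lambda : nat -> R) (r : nat).
Hypothesis hreldeg : has_relative_degree f g h r.
Let s := cbf_chain f h lambda.

(** Each s_k is a combination of h, L_f h, ..., L_f^k h with constant
    coefficients, so it inherits from them differentiability and the vanishing of
    L_g. Quantifying over all L_f^j s_k lets the induction on k go through without
    naming the coefficients, since L_f^j s_(k+1) = L_f^(j+1) s_k + lambda L_f^j s_k. *)
Lemma lie_input_iter_chain k j : (k + j < r)%N ->
  (forall z, differentiable (iter j (lie f) (s k)) z) /\
  ((k + j.+2 <= r)%N -> forall z, lie_input g (iter j (lie f) (s k)) z = 0).
Proof.
have [dh gh _] := hreldeg.
elim: k j => [|k IH] j kj; first by split; [exact: dh | exact: gh].
have itE i : (i <= j)%N -> iter i (lie f) (s k.+1) =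
    fun z => iter i.+1 (lie f) (s k) z + lambda k.+1 * iter i (lie f) (s k) z.
  elim: i => [//|i IHi] ij.
  rewrite iterS IHi ?(ltnW ij)//; apply/funext => z.
  have [|d1 _] := IH i.+1; first by lia.
  have [|d0 _] := IH i; first by lia.
  by rewrite lie_comb; [|exact: d1|exact: d0].
have [|d1 g1] := IH j.+1; first by lia.
have [|d0 g0] := IH j; first by lia.
rewrite itE//; split=> [z|kjr z].
  apply: differentiableD; first exact: d1.
  by apply: differentiableM; [exact: differentiable_cst|exact: d0].
rewrite lie_input_comb; [|exact: d1|exact: d0].
by rewrite g1 ?g0 ?scaler0 ?addr0//; lia.
Qed.

Hypothesis hlambda : forall k, (1 <= k <= r)%N -> 0 < lambda k.

(** A function that satisfies s_k' + lambda s_k >= 0 and starts nonnegative stays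
    nonnegative; applied from k = r - 2 down to k = 0. *)
Lemma chain_nonneg (u : R -> 'cV[R]_m) (x : R -> 'cV[R]_n) :
  (0 < r)%N -> plant_trajectory f g u x ->
  (forall k, (k < r)%N -> 0 <= s k (x 0)) ->
  (forall t : R, 0 <= t -> 0 <= s r.-1 (x t)) ->
  forall t : R, 0 <= t -> 0 <= h (x t).
Proof.
move=> r0 xP s0 slast.
(* Descending induction on k, written as induction on d = r - 1 - k. *)
suff H d : (d < r)%N -> forall t : R, 0 <= t -> 0 <= s (r.-1 - d) (x t).
  by have := H r.-1; rewrite subnn; apply; rewrite prednK.
elim: d => [_|d IH dr]; first by rewrite subn0.
set k := (r.-1 - d.+1)%N.
have kE : (r.-1 - d)%N = k.+1 by rewrite /k; lia.
have kr : (k.+1 < r)%N by rewrite /k; lia.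
have [|dsk gsk] := lie_input_iter_chain k 0; first by lia.
apply: (@exp_lower_bound _ (fun t => s k (x t)) _ (lambda k.+1) 0) => //.
- by rewrite ltW// hlambda//; lia.
- by rewrite s0//; lia.
- by move=> t t0; apply: is_derive_along; [exact: dsk|exact: xP].
- move=> t t0 /=; have := IH (ltnW dr) t t0; rewrite kE /= /lie.
  rewrite mulmxDr mulmxA.
  have := gsk ltac:(lia) (x t); rewrite /lie_input /= => ->.
  by rewrite mul0mx addr0.
Qed.

End Chain.

(** * Dissipation of the parameter estimation error *)

Section Barrier.
Context {R : realType} {n : nat}.
Implicit Types (G z : 'cV[R]_n).

Lemma gradient_s_eps (s : nat -> 'cV[R]_n -> R) (L : nat -> R) (M : R -> R)
    (r : nat) (eps t : R) z :
  differentiable (s r.-1) z ->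
  gradient ((s_eps s L M r eps)^~ t) z = gradient (s r.-1) z.
Proof.
move=> ds; apply/colP => i; rewrite !mxE.
have -> : (s_eps s L M r eps)^~ t = s r.-1 - cst (L r.-1 * M t + eps).
  by apply/funext => y; rewrite /s_eps /sM !fctE opprD addrA.
by rewrite deriveB ?derive_cst ?subr0//; exact: diff_derivable.
Qed.

Lemma is_derive_s_eps (s : nat -> 'cV[R]_n -> R) (L : nat -> R) (M : R -> R)
    (r : nat) (eps t : R) z :
  derivable M t 1 ->
  is_derive t 1 (s_eps s L M r eps z) (- (L r.-1 * 'D_1 M t)).
Proof.
move=> dM; have ? : is_derive t 1 M ('D_1 M t) by exact: derivableP.
have -> : s_eps s L M r eps z = cst (s r.-1 z - eps) - L r.-1 \*: M.
  by apply/funext => y; rewrite /s_eps /sM !fctE addrAC.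
by apply: is_derive_eq; rewrite sub0r.
Qed.

(** The right-hand side is what one coefficient contributes to W' + mu W, the
    right factor of the inner product being minus the derivative of the estimate.
    As 2 (eps / tb^2) (tb^2 / (2 eps)) = 1, the gradient part of the adaptation law
    exchanges th for tht in phi G . th. Its leakage - mu tht, together with the last
    term, completes a square: they add up to
    - mu (eps / tb^2) (|th|^2 - |tht|^2), which is at least - mu eps. *)
Lemma adaptation_dissipation G (th tht : 'cV[R]_n) (phi mu eps tb : R) :
  0 <= mu -> 0 < eps -> 0 < tb -> enorm th <= tb ->
  phi * (G^T *m tht) 0 0 - mu * eps <=
  phi * (G^T *m th) 0 0
  - eps / tb ^+ 2 * (2 * ((th - tht)^T *m
      (- (- ((tb ^+ 2 / (2 * eps) * phi) *: G) - mu *: tht))) 0 0)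
  - mu * (eps / tb ^+ 2 * enorm (th - tht) ^+ 2).
Proof.
move=> mu0 eps0 tb0 thtb; set c := eps / tb ^+ 2; set k := _ / _ * phi.
have c0 : 0 < c by rewrite divr_gt0// exprn_gt0.
have ck : c * k * 2 = phi by rewrite /c /k; field; rewrite !gt_eqF.
have ctb : c * tb ^+ 2 = eps by rewrite /c; field; rewrite gt_eqF.
have -> : ((th - tht)^T *m (- (- (k *: G) - mu *: tht))) 0 0 =
    k * (G^T *m th) 0 0 - k * (G^T *m tht) 0 0
    + mu * (th^T *m tht) 0 0 - mu * (tht^T *m tht) 0 0.
  rewrite !dotE !mulr_sumr -sumrB -big_split -sumrB; apply: eq_bigr => i _ /=.
  by rewrite !mxE; ring.
rewrite sqr_enormB.
have -> : (tht^T *m tht) 0 0 = enorm tht ^+ 2.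
  by rewrite dotE sqr_enorm; apply: eq_bigr.
have th2 : enorm th ^+ 2 <= tb ^+ 2.
  by rewrite ler_pXn2r ?nnegrE ?enorm_ge0// ltW.
have cth : mu * (c * enorm th ^+ 2) <= mu * eps.
  by rewrite ler_wpM2l// -ctb ler_wpM2l// ltW.
have cmu : 0 <= mu * (c * enorm tht ^+ 2).
  by rewrite mulr_ge0// mulr_ge0 ?sqr_ge0// ltW.
rewrite -ck; nra.
Qed.

(** The weights are the ones for which the adaptation gains cancel the unknown
    parameters in W', and they make each term at most eps when the estimate is 0. *)
Definition estimation_cost (N : nat) (eps : R) (thetabar : 'I_N -> R)
    (theta : 'I_N -> 'cV[R]_n) (thetahat : 'M[R]_(n, N)) : R :=
  \sum_(i < N) eps / thetabar i ^+ 2 * enorm (theta i - col i thetahat) ^+ 2.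

Lemma estimation_cost_ge0 (N : nat) (eps : R) (thetabar : 'I_N -> R)
    (theta : 'I_N -> 'cV[R]_n) (thetahat : 'M[R]_(n, N)) :
  0 <= eps -> 0 <= estimation_cost N eps thetabar theta thetahat.
Proof.
move=> eps0; apply: sumr_ge0 => i _.
by rewrite mulr_ge0 ?divr_ge0 ?sqr_ge0.
Qed.

(** By the triangle inequality the i-th summand is at most
    (eps / thetabar_i^2) (thetabar_i + |thetahat_i|)^2; expanding the square gives
    the i-th part of the denominator in the bound on eps. *)
Lemma estimation_cost_le (N : nat) (eps : R) (thetabar : 'I_N -> R)
    (theta : 'I_N -> 'cV[R]_n) (thetahat : 'M[R]_(n, N)) :
  0 < eps -> (forall i, 0 < thetabar i) ->
  (forall i, enorm (theta i) <= thetabar i) ->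
  estimation_cost N eps thetabar theta thetahat <=
  eps * (N%:R + \sum_(i < N) (2 * enorm (col i thetahat) / thetabar i
                   + enorm (col i thetahat) ^+ 2 / thetabar i ^+ 2)).
Proof.
move=> eps0 tb0 thtb.
have -> : N%:R = \sum_(i < N) 1 :> R by rewrite sumr_const card_ord.
rewrite -big_split mulr_sumr; apply: ler_sum => i _ /=.
apply: (@le_trans _ _ (eps / thetabar i ^+ 2 *
  (thetabar i + enorm (col i thetahat)) ^+ 2)).
  rewrite ler_wpM2l ?divr_ge0 ?sqr_ge0 ?(ltW eps0)//.
  rewrite (le_trans (sqr_enormB_le _ _))//.
  have := enorm_ge0 (theta i); have := enorm_ge0 (col i thetahat).
  by have := thtb i; have := tb0 i; nra.
rewrite le_eqVlt; apply/orP; left; apply/eqP; field.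
by rewrite gt_eqF.
Qed.

(** The energy W of the closed loop satisfies W' + mu W >= 0: summing
    [adaptation_dissipation] over i turns the derivative of s_eps along the
    observer into the left-hand side of the inequality that defines K_BF. *)
Lemma barrier_energy_ge (m N r : nat)
    (f : 'cV[R]_n -> 'cV[R]_n) (g : 'cV[R]_n -> 'M[R]_(n, m))
    (s : nat -> 'cV[R]_n -> R) (L : nat -> R) (M : R -> R)
    (omega E mu eps : R) (theta : 'I_N -> 'cV[R]_n) (thetabar : 'I_N -> R)
    (epsLambda : R -> 'cV[R]_n) (u : R -> 'cV[R]_m)
    (xhat : R -> 'cV[R]_n) (thetahat : R -> 'M[R]_(n, N)) :
  let se := s_eps s L M r eps in
  let W t := se (xhat t) t - estimation_cost N eps thetabar theta (thetahat t) in
  (forall z, differentiable (s r.-1) z) ->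
  (forall t : R, 0 <= t -> derivable M t 1) ->
  reconstructed_trajectory f g omega theta epsLambda u xhat ->
  (forall t : R, 0 <= t -> enorm (epsLambda t) <= E) ->
  (forall i, 0 < thetabar i) ->
  (forall i, enorm (theta i) <= thetabar i) ->
  0 < mu -> 0 < eps ->
  adaptation_law se omega mu eps thetabar xhat thetahat ->
  (forall t : R, 0 <= t ->
     K_BF f g se omega mu eps E (xhat t) (thetahat t) t (u t)) ->
  - eps <= W 0 -> forall t : R, 0 <= t -> - eps <= W t.
Proof.
move=> se W ds dM xhatP epsLE tb0 thtb mu0 eps0 thP uP W0.
(* The parameters being constant, theta_i - thetahat_i has as its derivative
   minus the right-hand side of the adaptation law. *)
pose dsth i (t : R) :=
  - (- ((thetabar i ^+ 2 / (2 * eps) * trig_basis omega i.+1 t)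
       *: gradient (s r.-1) (xhat t)) - mu *: col i (thetahat t)).
pose dxhat (t : R) := f (xhat t) + g (xhat t) *m u t
  + \sum_(i < N) trig_basis omega i.+1 t *: theta i + epsLambda t.
pose dW (t : R) := ((gradient (s r.-1) (xhat t))^T *m dxhat t) 0 0
  - L r.-1 * 'D_1 M t
  - \sum_(i < N) eps / thetabar i ^+ 2 *
      (2 * ((theta i - col i (thetahat t))^T *m dsth i t) 0 0).
apply: (@exp_lower_bound _ W dW mu) => //;
  rewrite ?oppr_le0 ?(ltW mu0) ?(ltW eps0)// => t t0.
  have ? : is_derive t 1 M ('D_1 M t) by apply/derivableP/dM.
  have ? : is_derive t 1 (fun tau => s r.-1 (xhat tau))
      (((gradient (s r.-1) (xhat t))^T *m dxhat t) 0 0).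
    by apply: is_derive_along => //; exact: xhatP.
  have ? i : is_derive t 1
      (fun tau => enorm (theta i - col i (thetahat tau)) ^+ 2)
      (2 * ((theta i - col i (thetahat t))^T *m dsth i t) 0 0).
    apply: is_derive_sqr_enorm.
    have := thP i t t0; rewrite gradient_s_eps// => ?.
    by apply: is_derive_eq; rewrite sub0r.
  have -> : W = (fun tau => s r.-1 (xhat tau)) - L r.-1 \*: M - cst eps
    - \sum_(i < N) (eps / thetabar i ^+ 2) \*:
        (fun tau => enorm (theta i - col i (thetahat tau)) ^+ 2).
    by apply/funext => tau; rewrite /W !fctE fct_sumE.
  by apply: is_derive_eq; rewrite subr0.
have := uP t t0.
rewrite /K_BF /= /lie_input /lie gradient_s_eps//.
rewrite derive1E; have [_ ->] := is_derive_s_eps s L M r eps _ (xhat t) (dM t t0).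
rewrite /dW /W /estimation_cost -/se /dxhat /f_tilde.
set G := gradient _ _.
have : - (enorm G * E) <= (G^T *m epsLambda t) 0 0.
  have := cauchy_schwarz G (epsLambda t); rewrite ler_norml => /andP[+ _].
  by have := enorm_ge0 G; have := epsLE t t0; nra.
have dot_sum (c : 'I_N -> R) (w : 'I_N -> 'cV[R]_n) :
    (G^T *m \sum_(i < N) c i *: w i) 0 0 =
    \sum_(i < N) c i * (G^T *m w i) 0 0.
  rewrite mulmx_sumr summxE; apply: eq_bigr => i _.
  by rewrite -scalemxAr mxE.
have mxD (A B : 'M[R]_1) : (A + B) 0 0 = A 0 0 + B 0 0 by rewrite mxE.
have := @ler_sum R 'I_N (index_enum _) xpredT _ _ (fun i _ =>
  adaptation_dissipation G (theta i) (col i (thetahat t))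
    (trig_basis omega i.+1 t) mu eps (thetabar i)
    (ltW mu0) eps0 (tb0 i) (thtb i)).
rewrite !sumrB sumr_const card_ord -[_ *+ N]mulr_natr.
rewrite !mulmxDr mulmxA !mxD !dot_sum -/G.
rewrite /dsth -/G.
move=> diss epsG barrier; rewrite (mulrBr mu (se _ _)) mulr_sumr.
by lra.
Qed.

End Barrier.

(** * Forward invariance *)

Theorem theorem2 (R : realType) (n m p N r : nat)
  (* plant, output map, observer and its error bound *)
  (f : 'cV[R]_n -> 'cV[R]_n) (g : 'cV[R]_n -> 'M[R]_(n, m))
  (l : 'cV[R]_n -> 'cV[R]_p)
  (v : 'cV[R]_n -> 'cV[R]_p -> 'cV[R]_m -> 'cV[R]_n)
  (M : R -> 'cV[R]_n -> 'cV[R]_n -> R)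
  (* barrier function and constants *)
  (h : 'cV[R]_n -> R) (lambda L : nat -> R)
  (omega E mu eps : R)
  (theta : 'I_N -> 'cV[R]_n) (thetabar : 'I_N -> R)
  (epsLambda : R -> 'cV[R]_n)
  (* controller and closed-loop trajectory *)
  (kappa : 'cV[R]_n * 'M[R]_(n, N) * R -> 'cV[R]_m)
  (x xhat : R -> 'cV[R]_n) (thetahat : R -> 'M[R]_(n, N)) :
  let s := cbf_chain f h lambda in
  let u := fun t : R => kappa (xhat t, thetahat t, t) in
  let Mt := fun t : R => M t (x 0) (xhat 0) in
  let se := s_eps s L Mt r eps in
  (2 <= r)%N ->
  (0 < N)%N ->
  locally_lipschitz_on setT f ->
  locally_lipschitz_on setT g ->
  is_Ck r h ->
  has_relative_degree f g h r ->
  (forall k, (1 <= k <= r)%N -> 0 < lambda k) ->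
  (forall k, (k < r)%N -> is_Ck 1 (s k)) ->
  (forall k, (k < r)%N -> 0 < L k) ->
  (forall k, (k < r)%N ->
     forall z z', `|s k z - s k z'| <= L k * enorm (z - z')) ->
  error_bound M ->
  plant_trajectory f g u x ->
  eeq_observer_trajectory l v M u x xhat ->
  reconstructed_trajectory f g omega theta epsLambda u xhat ->
  0 < E ->
  (forall t : R, 0 <= t -> enorm (epsLambda t) <= E) ->
  (forall i, 0 < thetabar i) ->
  (forall i, enorm (theta i) <= thetabar i) ->
  0 < mu ->
  0 < eps ->
  adaptation_law se omega mu eps thetabar xhat thetahat ->
  eps <= eps_bound r s L Mt thetabar (xhat 0) (thetahat 0) ->
  locally_lipschitz_on
    [set q : 'cV[R]_n * 'M[R]_(n, N) * R | 0 <= q.2] kappa ->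
  (forall z (th : 'M[R]_(n, N)) (t : R), 0 <= t ->
     K_BF f g se omega mu eps E z th t (kappa (z, th, t))) ->
  forall t : R, 0 <= t -> safe_set h (x t).
Proof.
move=> s u Mt se r2 N0 _ _ _ reldeg lambda0 C1s L0 lips boundM xP [_ xhatM]
  xhatP E0 epsLE tb0 thtb mu0 eps0 thP epsB _ kappaP.
have rlt : (r.-1 < r)%N by lia.
have robust k (t : R) : (k < r)%N -> 0 <= t ->
    sM s L Mt k (xhat t) t <= s k (x t).
  move=> kr t0; have := lips k kr (xhat t) (x t).
  rewrite ler_norml => /andP[_]; rewrite /sM.
  have : L k * enorm (xhat t - x t) <= L k * Mt t.
    by rewrite ler_wpM2l ?xhatM// ltW// L0.
  by lra.
(* The denominator of the bound on eps is N + D. *)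
pose D := \sum_(i < N) (2 * enorm (col i (thetahat 0)) / thetabar i
                   + enorm (col i (thetahat 0)) ^+ 2 / thetabar i ^+ 2).
have D0 : 0 <= D.
  apply: sumr_ge0 => i _; have /ltW ? := tb0 i.
  by rewrite addr_ge0// divr_ge0// ?sqr_ge0// mulr_ge0// enorm_ge0.
have ND0 : 0 < N%:R + D by rewrite ltr_pwDl// ltr0n.
have margin k : (k < r)%N -> eps * (N%:R + D) <= sM s L Mt k (xhat 0) 0.
  move=> kr; move: epsB; rewrite /eps_bound -/D ler_pdivlMr// => /le_trans.
  apply; case: k kr => [|k] kr; first exact: bigmin_le_id.
  by apply: (@bigmin_inf_seq _ _ _ _ _ k.+1); rewrite ?mem_index_iota.
have slast (t : R) : 0 <= t -> 0 <= s r.-1 (x t).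
  move=> t0; apply: le_trans (robust _ _ rlt t0).
  have dM (tau : R) : 0 <= tau -> derivable Mt tau 1.
    by move=> /(boundM (x 0) (xhat 0))[].
  have ds z : differentiable (s r.-1) z by have [] := C1s _ rlt.
  have uP (tau : R) : 0 <= tau ->
      K_BF f g se omega mu eps E (xhat tau) (thetahat tau) tau (u tau).
    exact: kappaP.
  have W0 : - eps <= se (xhat 0) 0
      - estimation_cost N eps thetabar theta (thetahat 0).
    have := estimation_cost_le N eps thetabar theta (thetahat 0) eps0 tb0 thtb.
    by have := margin _ rlt; rewrite -/D /se /s_eps; lra.
  have := barrier_energy_ge _ _ _ _ _ _ _ _ _ _ _ _ _ _ _ _ _ _
    ds dM xhatP epsLE tb0 thtb mu0 eps0 thP uP W0 t t0.
  have := estimation_cost_ge0 N eps thetabar theta (thetahat t) (ltW eps0).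
  by rewrite /s_eps; lra.
apply: (chain_nonneg _ _ _ _ _ reldeg lambda0 _ _ _ xP) => // [|k kr].
  by lia.
apply: le_trans (robust _ _ kr _) => //; apply: le_trans (margin k kr).
by rewrite mulr_ge0// ltW.
Qed.
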